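(* Let $k\geq 2$ be an integer and, for $n\geq 0$, let $f_{k,n}$ denote the number of cyclic weakly even-up words over $k$ of length $n$. Let $F_k(x)=\sum_{n\geq 0}f_{k,n}x^n$. Then \[F_k(x)=\left\lfloor\frac{k}{2}\right\rfloor\frac{x}{1-x}+\frac{2(1-x)^{\lceil k/2\rceil}+\lceil k/2\rceil x-1}{(2-x)(1-x)^{\lceil k/2\rceil}+x-1}.\]
   Context: For an integer $k\geq 2$, let $[k]=\{1,\ldots,k\}$. A word over $k$ of length $n$ is an element $w_1\cdots w_n\in[k]^n$ (for $n=0$ there is exactly one word, the empty word, which is counted). A word $w_1\cdots w_n\in[k]^n$ is cyclic weakly even-up if for every $i\in[n]$, whenever $w_i$ is even, $w_{i+1}\geq w_i$, where $w_{n+1}$ is defined to be $w_1$. *)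

(* Defs.v *)
From HB Require Import structures.
From mathcomp Require Import all_boot all_order all_algebra.
From mathcomp Require Import boolp.

Set Implicit Arguments.
Unset Strict Implicit.
Unset Printing Implicit Defensive.

Import GRing.Theory.

Local Open Scope ring_scope.

(* Formal power series, kept as a record because functions into a ring already
   carry the pointwise product. *)
Record fps (R : Type) := Fps { fpscoef : nat -> R }.

HB.instance Definition _ (R : Type) := gen_eqMixin (fps R).
HB.instance Definition _ (R : Type) := gen_choiceMixin (fps R).

Lemma fpsP (R : Type) (f g : fps R) : fpscoef f =1 fpscoef g -> f = g.
Proof. by case: f g => [f] [g] /= /funext ->. Qed.

Section FpsRing.

Variable R : comUnitRingType.
Implicit Types f g h : fps R.

Definition fps_zero : fps R := Fps (fun=> 0).
Definition fps_one : fps R := Fps (fun n => (n == 0%N)%:R).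
Definition fps_opp f : fps R := Fps (fun n => - fpscoef f n).
Definition fps_add f g : fps R := Fps (fun n => fpscoef f n + fpscoef g n).
Definition fps_mul f g : fps R :=
  Fps (fun n => \sum_(i < n.+1) fpscoef f i * fpscoef g (n - i)).

Fact fps_addA : associative fps_add.
Proof. by move=> f g h; apply: fpsP => n /=; rewrite addrA. Qed.
Fact fps_addC : commutative fps_add.
Proof. by move=> f g; apply: fpsP => n /=; rewrite addrC. Qed.
Fact fps_add0 : left_id fps_zero fps_add.
Proof. by move=> f; apply: fpsP => n /=; rewrite add0r. Qed.
Fact fps_addN : left_inverse fps_zero fps_opp fps_add.
Proof. by move=> f; apply: fpsP => n /=; rewrite addNr. Qed.

HB.instance Definition _ :=
  GRing.isZmodule.Build (fps R) fps_addA fps_addC fps_add0 fps_addN.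

Definition fps_trunc n f : {poly R} := \poly_(i < n.+1) fpscoef f i.

Lemma coef_fps_trunc n f i :
  (i <= n)%N -> (fps_trunc n f)`_i = fpscoef f i.
Proof. by move=> le_in; rewrite coef_poly ltnS le_in. Qed.

Lemma fps_mul_trunc n f g i : (i <= n)%N ->
  fpscoef (fps_mul f g) i = (fps_trunc n f * fps_trunc n g)`_i.
Proof.
move=> le_in; rewrite coefM /=; apply: eq_bigr => j _.
have le_ji : (j <= i)%N by rewrite -ltnS.
rewrite !coef_fps_trunc ?(leq_trans le_ji) //.
exact: leq_trans (leq_subr _ _) le_in.
Qed.

Fact fps_mulA : associative fps_mul.
Proof.
move=> f g h; apply: fpsP => n.
transitivity (fps_trunc n f * (fps_trunc n g * fps_trunc n h))`_n.
  rewrite coefM /=; apply: eq_bigr => i _.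
  have le_in : (i <= n)%N by rewrite -ltnS.
  by rewrite coef_fps_trunc // -fps_mul_trunc ?leq_subr.
rewrite mulrA coefM /=; apply: eq_bigr => i _.
rewrite [X in _ * X]coef_fps_trunc ?leq_subr //; congr (_ * _).
by rewrite -fps_mul_trunc // -ltnS.
Qed.
Fact fps_mulC : commutative fps_mul.
Proof.
by move=> f g; apply: fpsP => n; rewrite !(@fps_mul_trunc n) // mulrC.
Qed.
Fact fps_mul1 : left_id fps_one fps_mul.
Proof.
move=> f; apply: fpsP => n /=; rewrite big_ord_recl mul1r subn0.
by rewrite big1 ?addr0 // => i _; rewrite mul0r.
Qed.
Fact fps_mulD : left_distributive fps_mul fps_add.
Proof.
move=> f g h; apply: fpsP => n /=; rewrite -big_split.
by apply: eq_bigr => i _; rewrite mulrDl.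
Qed.
Fact fps_one_neq0 : fps_one != 0.
Proof.
by apply/eqP => /(congr1 (fun f => fpscoef f 0)) /eqP; rewrite oner_eq0.
Qed.

HB.instance Definition _ :=
  GRing.Zmodule_isComNzRing.Build (fps R)
    fps_mulA fps_mulC fps_mul1 fps_mulD fps_one_neq0.

(* The inverse g of f satisfies
   g_n = f_0^-1 ([n = 0] - \sum_(i < n) g_i f_(n - i)); the recursion carries
   the list of the coefficients already computed. *)
Definition fps_inv_next f (s : seq R) : R :=
  (fpscoef f 0)^-1 *
  ((size s == 0%N)%:R - \sum_(i < size s) s`_i * fpscoef f (size s - i)).

Definition fps_inv_seq f n : seq R :=
  iter n (fun s => rcons s (fps_inv_next f s)) [::].

Definition fps_unit : {pred fps R} :=
  [pred f | fpscoef f 0 \is a GRing.unit].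

Definition fps_inv f : fps R :=
  if f \in fps_unit then Fps (fun n => fps_inv_next f (fps_inv_seq f n)) else f.

Lemma size_fps_inv_seq f n : size (fps_inv_seq f n) = n.
Proof. by elim: n => //= n IHn; rewrite size_rcons IHn. Qed.

Lemma nth_fps_inv_seq f n i : (i < n)%N ->
  (fps_inv_seq f n)`_i = fps_inv_next f (fps_inv_seq f i).
Proof.
elim: n => //= n IHn; rewrite ltnS leq_eqVlt nth_rcons size_fps_inv_seq.
by case/predU1P => [->|lt_in]; rewrite ?ltnn ?eqxx // lt_in IHn.
Qed.

Fact fps_mulV : {in fps_unit, left_inverse 1 fps_inv *%R}.
Proof.
move=> f Uf; rewrite /fps_inv Uf; apply: fpsP => n /=.
rewrite big_ord_recr /= subnn [X in X * fpscoef f 0]/fps_inv_next.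
rewrite size_fps_inv_seq mulrAC mulVr // mul1r.
rewrite addrC -addrA -[RHS]addr0; congr (_ + _).
apply/eqP; rewrite addrC subr_eq0; apply/eqP/eq_bigr => i _.
by rewrite nth_fps_inv_seq.
Qed.

Fact fps_unitPl f g : g * f = 1 -> f \in fps_unit.
Proof.
move/(congr1 (fun h => fpscoef h 0)); rewrite /= big_ord1 => gf1.
by rewrite inE; apply/unitrPr; exists (fpscoef g 0); rewrite mulrC.
Qed.

Fact fps_inv_out : {in [predC fps_unit], fps_inv =1 id}.
Proof. by move=> f; rewrite inE /= /fps_inv => /negbTE ->. Qed.

HB.instance Definition _ :=
  GRing.ComNzRing_hasMulInverse.Build (fps R)
    fps_mulV fps_unitPl fps_inv_out.

Definition fpsX : fps R := Fps (fun n => (n == 1%N)%:R).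

Lemma fps_unitE f :
  (f \is a GRing.unit) = (fpscoef f 0 \is a GRing.unit).
Proof. by []. Qed.

End FpsRing.

Arguments fpsX {R}.

(* The ordinal a : 'I_k, ranging over 0, ..., k - 1, stands for the letter
   a + 1 of [k] = {1, ..., k}. *)
Definition letter (k : nat) (a : 'I_k) : nat := a.+1.

(* ordS is the cyclic successor, so the last letter is followed by the first *)
Definition cyclic_weakly_even_up (k n : nat) (w : n.-tuple 'I_k) : bool :=
  [forall i : 'I_n, ~~ odd (letter (tnth w i)) ==>
    (letter (tnth w i) <= letter (tnth w (ordS i)))%N].

Definition nb_cyclic_weakly_even_up (k n : nat) : nat :=
  #|[set w : n.-tuple 'I_k | cyclic_weakly_even_up w]|.

Definition gf_cyclic_weakly_even_up (k : nat) : fps rat :=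
  Fps (fun n => (nb_cyclic_weakly_even_up k n)%:R).

(* Main.v *)
(* For n > 0 the number of words is the trace of A ^+ n, where A is the
   transition matrix of the letters, so the generating function is, up to the
   constant term, the trace of the resolvent (1 - x A)^-1 over power series.
   The rows of A at odd letters are all 1, hence A = E + u v with v the all-one
   row and E supported on the rows of even letters. E is triangular and its
   resolvent has entries in powers of c = (1 - x)^-1; the rank one term is
   then accounted for as in the Sherman-Morrison formula. *)
Require Import Defs.
From mathcomp Require Import all_boot all_order all_algebra.
From mathcomp Require Import ring.

Set Implicit Arguments.
Unset Strict Implicit.
Unset Printing Implicit Defensive.

Import GRing.Theory.

Local Open Scope ring_scope.

(** * Cyclic words as closed walks, counted by traces of matrix powers *)

Lemma sum_tuple_cons (T : finType) (V : nmodType) n (F : n.+1.-tuple T -> V) :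
  \sum_w F w = \sum_a \sum_(w : n.-tuple T) F [tuple of a :: w].
Proof.
rewrite pair_bigA /=.
rewrite (reindex (fun p : T * n.-tuple T => [tuple of p.1 :: p.2])) //=.
exists (fun w => (thead w, [tuple of behead w])) => [[a w] _|w _] /=.
  by congr (_, _); apply: val_inj.
by rewrite [RHS]tuple_eta; apply: val_inj.
Qed.

Definition adjmx (R : pzRingType) (k : nat) (e : rel 'I_k) : 'M[R]_k :=
  \matrix_(a, b) (e a b)%:R.

(** The word [w] lists the [n] interior vertices of a walk from [a] to [b], which has [n.+1]
    steps. *)
Lemma adjmx_exp (R : pzRingType) k (e : rel 'I_k) n a b :
  (adjmx R e ^+ n.+1) a b = \sum_(w : n.-tuple 'I_k) (path e a (rcons w b))%:R.
Proof.
elim: n a => [|n IHn] a.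
  rewrite expr1 mxE (big_pred1 [tuple]) /= ?andbT //.
  by move=> w; apply/esym/eqP; apply: val_inj; case: w => [[]].
rewrite sum_tuple_cons exprS mxE; apply: eq_bigr => d _.
rewrite IHn mxE mulr_sumr; apply: eq_bigr => w _ /=.
by rewrite -natrM mulnb.
Qed.

Lemma mxtrace_adjmx_exp (R : pzRingType) k (e : rel 'I_k) n :
  \tr (adjmx R e ^+ n.+1) = #|[set w : n.+1.-tuple 'I_k | cycle e w]|%:R.
Proof.
rewrite -sum1_card natr_sum big_mkcond sum_tuple_cons /mxtrace.
apply: eq_bigr => a _; rewrite adjmx_exp; apply: eq_bigr => w _.
by rewrite inE /=; case: path.
Qed.

(** A cycle through [x :: s] is a path from [x] along [rcons s x]; the appended [x] is the letter
    that [ordS] reaches from the last index. *)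
Lemma cycle_tnthP (T : eqType) n (e : rel T) (w : n.-tuple T) :
  reflect (forall i, e (tnth w i) (tnth w (ordS i))) (cycle e w).
Proof.
case: n w => [|n] w; first by rewrite tuple0; apply: ReflectT => -[].
case/tupleP: w => x s.
have cur (i : 'I_n.+1) : nth x (x :: rcons s x) i = tnth [tuple of x :: s] i.
  by rewrite (tnth_nth x) -rcons_cons nth_rcons /= size_tuple ltn_ord.
have next (i : 'I_n.+1) :
    nth x (rcons s x) i = tnth [tuple of x :: s] (ordS i).
  rewrite (tnth_nth x) nth_rcons size_tuple /=.
  have := ltn_ord i; rewrite ltnS leq_eqVlt => /predU1P[->|i_lt].
    by rewrite ltnn eqxx modnn.
  by rewrite i_lt modn_small.
apply: (iffP (pathP x)) => [es i|es i].
  by rewrite -cur -next es // size_rcons size_tuple.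
rewrite size_rcons size_tuple => i_lt.
by have := es (Ordinal i_lt); rewrite -cur -next.
Qed.

Definition even_up k : rel 'I_k :=
  fun a b => ~~ odd (letter a) ==> (letter a <= letter b)%N.

Lemma cyclic_weakly_even_upE k n (w : n.-tuple 'I_k) :
  cyclic_weakly_even_up w = cycle (@even_up k) w.
Proof. by apply/forallP/cycle_tnthP. Qed.

Lemma nb_cyclic_weakly_even_upS (R : pzRingType) k n :
  (nb_cyclic_weakly_even_up k n.+1)%:R = \tr (adjmx R (@even_up k) ^+ n.+1).
Proof.
rewrite mxtrace_adjmx_exp; congr _%:R; apply: eq_card => w.
by rewrite !inE cyclic_weakly_even_upE.
Qed.

Lemma nb_cyclic_weakly_even_up0 k : nb_cyclic_weakly_even_up k 0 = 1%N.
Proof.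
rewrite /nb_cyclic_weakly_even_up (eq_card (_ : _ =i [set [tuple]])) ?cards1 //.
by move=> w; rewrite tuple0 !inE eqxx; apply/forallP => -[].
Qed.

(** * Power series coefficients and the resolvent series *)

Section FpsCoef.
Variable R : comUnitRingType.
Implicit Types f g : fps R.

Lemma fpscoefD f g n : fpscoef (f + g) n = fpscoef f n + fpscoef g n.
Proof. by []. Qed.

Lemma fpscoef_sum I r (P : pred I) (F : I -> fps R) n :
  fpscoef (\sum_(i <- r | P i) F i) n = \sum_(i <- r | P i) fpscoef (F i) n.
Proof. by elim/big_rec2: _ => // i f s _ <-. Qed.

Lemma fpscoef_natr m n : fpscoef (m%:R : fps R) n = (m * (n == 0))%:R.
Proof. by elim: m => // m IHm; rewrite mulrSr mulSn addnC natrD -IHm. Qed.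

Lemma fpscoefM0 f g : fpscoef (f * g) 0 = fpscoef f 0 * fpscoef g 0.
Proof. by rewrite /= big_ord1. Qed.

Lemma fpscoefX0 f n : fpscoef (f ^+ n) 0 = fpscoef f 0 ^+ n.
Proof. by elim: n => // n IHn; rewrite !exprS fpscoefM0 IHn. Qed.

Lemma fpscoefXM0 f : fpscoef (fpsX * f) 0 = 0.
Proof. by rewrite /= big_ord1 mul0r. Qed.

Lemma fpscoefXMS f n : fpscoef (fpsX * f) n.+1 = fpscoef f n.
Proof.
rewrite /= !big_ord_recl mul0r add0r mul1r subSS subn0 big1 ?addr0 // => i _.
by rewrite mul0r.
Qed.

End FpsCoef.

(** Multiplication by [fpsX] shifts degrees by one, so in degree [n.+1] the terms A^(n+1) and A A^n
    cancel. *)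
Lemma resolvent_fps (R : comUnitRingType) k (e : rel 'I_k) :
  (1%:M - fpsX *: adjmx (fps R) e) *m
    \matrix_(a, b) Fps (fun n => (adjmx R e ^+ n) a b) = 1%:M.
Proof.
apply/matrixP => a b; rewrite mulmxBl mul1mx -scalemxAl !mxE.
apply/eqP; rewrite subr_eq; apply/eqP/fpsP => n; rewrite fpscoefD.
case: n => [|n].
  by rewrite fpscoefXM0 addr0 fpscoef_natr /= expr0 mxE muln1.
rewrite fpscoefXMS fpscoef_natr muln0 add0r fpscoef_sum [LHS]/= exprS mxE.
by apply: eq_bigr => d _; rewrite !mxE !mulr_natl; case: (e _ _).
Qed.

(* Sherman-Morrison with the denominator cleared: z = v B^-1, y = v B^-2 and
   W = (B - u v)^-1. *)
Lemma mxtrace_rank1_update (R : comPzRingType) k (B B' W : 'M[R]_k)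
    (u : 'cV_k) (v y z : 'rV_k) :
  (B - u *m v) *m W = 1%:M -> B *m B' = 1%:M -> z *m B = v -> y *m B = z ->
  (1 - (z *m u) 0 0) * (\tr W - \tr B') = (y *m u) 0 0.
Proof.
move=> NW1 BB1 zB yB; have WN1 := mulmx1C NW1.
(* Resolvent identity W - B' = W (u v) B', followed by cyclicity of the trace. *)
have trE : \tr W - \tr B' = (z *m W *m u) 0 0.
  have -> : z = v *m B' by rewrite -zB -mulmxA BB1 mulmx1.
  rewrite -trace_mx11 -mulmxA mxtrace_mulC -mulmxA [u *m _]mulmxA.
  have -> : u *m v = B - (B - u *m v) by rewrite subKr.
  by rewrite mulmxBl BB1 mulmxBr mulmx1 mulmxA WN1 mul1mx raddfB.
have scal (t : 'rV[R]_k) : t *m u *m v = (t *m u) 0 0 *: v.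
  by rewrite {1}[t *m u]mx11_scalar mul_scalar_mx.
(* This and [yzW] come from multiplying [z], resp. [y], by B - u v on the right, then by [W]. *)
have zvW : z = (1 - (z *m u) 0 0) *: (v *m W).
  rewrite -[LHS]mulmx1 -NW1 mulmxA mulmxBr zB mulmxA scal scalemxAl.
  by rewrite scalerBl scale1r.
have yzW : z *m W = y + (y *m u) 0 0 *: (v *m W).
  apply/eqP; rewrite -subr_eq; apply/eqP.
  by rewrite -[RHS]mulmx1 -NW1 mulmxA mulmxBr yB mulmxA scal mulmxBl -scalemxAl.
have coefD (s t : 'rV[R]_k) a : ((s + a *: t) *m u) 0 0 =
    (s *m u) 0 0 + a * (t *m u) 0 0 by rewrite mulmxDl -scalemxAl !mxE.
have zu : (z *m u) 0 0 = (1 - (z *m u) 0 0) * (v *m W *m u) 0 0.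
  by rewrite {1}zvW -scalemxAl mxE.
(* The factor 1 - z u turns v W u into z u, so nothing has to be divided. *)
by rewrite trE yzW coefD mulrDr mulrCA -zu; ring.
Qed.

(** * Sums over indices of a fixed parity *)

(** On the odd numbers d = 2j - 1 the value [uphalf d] is j, so it runs through consecutive
    integers. *)
Lemma sum_odd_uphalf (V : nmodType) (h : nat -> V) a m :
  \sum_(a <= d < (a + m).+1 | odd d) h (uphalf d) =
    \sum_(a./2.+1 <= j < (uphalf (a + m)).+1) h j.
Proof.
elim: m => [|m IHm].
  rewrite addn0 big_mkcond big_nat1 uphalf_half.
  by case: odd; rewrite ?big_nat1 // big_geq.
rewrite addnS big_mkcond big_nat_recr ?leqW ?leq_addr //= -big_mkcond IHm /=.
rewrite uphalf_half; case: (odd _) => /=; first by rewrite addr0.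
by rewrite [RHS]big_nat_recr //= ?ltnS half_leq // leq_addr.
Qed.

Lemma sum_odd_ord (V : nmodType) k (b : 'I_k) a (h : nat -> V) : (a <= b)%N ->
  \sum_(d < k | odd d && (a <= d <= b)%N) h (uphalf d) =
    \sum_(a./2 <= j < uphalf b) h j.+1.
Proof.
move=> le_ab; rewrite -(big_add1 _ _ a./2 (uphalf b).+1 predT h).
have := sum_odd_uphalf h a (b - a); rewrite subnKC // => <-.
rewrite (big_nat_widen _ _ k) // big_geq_mkord; apply: eq_bigl => d.
by rewrite ltnS andbA andbAC.
Qed.

Lemma sum_even_ord (V : nmodType) k (h : nat -> V) :
  \sum_(d < k | ~~ odd d) h (uphalf d) = \sum_(j < uphalf k) h j.
Proof.
elim: k => [|k IHk]; first by rewrite !big_ord0.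
rewrite big_mkcond big_ord_recr -big_mkcond /= IHk uphalf_half.
by case: odd; rewrite /= ?addr0 // add0n big_ord_recr.
Qed.

(** * Resolvent of the even rows and the rank one correction *)

Section Resolvent.
Variables (R : comPzRingType) (x c : R) (k : nat).
Hypothesis cE : c * (1 - x) = 1.

(* Letters are shifted by one: the index a is an even letter iff a is odd, and
   uphalf a is the number of even letters up to that of index a. *)
Definition evenmx : 'M[R]_k := \matrix_(a, b) (odd a && (a <= b)%N)%:R.

(** This is E (1 - x E)^-1 for E = [evenmx]; the exponent counts the odd indices between [a] and
    [b], both included. *)
Definition evenmx_geo : 'M[R]_k :=
  \matrix_(a, b) (c ^+ (uphalf b - a./2) *+ (odd a && (a <= b)%N)).

(** Rows that depend on the index only through [uphalf] are stable under [evenmx], which reduces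
    linear systems to recurrences on [h]. *)
Lemma row_evenmx (h : nat -> R) :
  (\row_a h (uphalf a)) *m evenmx = \row_b \sum_(j < uphalf b) h j.+1.
Proof.
apply/rowP => b; rewrite !mxE.
rewrite -(big_mkord xpredT (fun j => h j.+1)) -(sum_odd_ord h (leq0n b)).
rewrite [RHS]big_mkcond; apply: eq_bigr => a _; rewrite !mxE.
by case: ifP => _; rewrite ?mulr1 ?mulr0.
Qed.

Lemma row_resolvent_evenmx (h : nat -> R) :
  (\row_a h (uphalf a)) *m (1%:M - x *: evenmx) =
    \row_b (h (uphalf b) - x * \sum_(j < uphalf b) h j.+1).
Proof.
by apply/rowP => b; rewrite mulmxBr mulmx1 -scalemxAr row_evenmx !mxE.
Qed.

Lemma geo_evenmx (a b : 'I_k) : odd a -> (a <= b)%N ->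
  (evenmx_geo *m evenmx) a b = \sum_(j < uphalf b - a./2) c ^+ j.+1.
Proof.
move=> odd_a le_ab.
transitivity (\sum_(d < k | odd d && (a <= d <= b)%N) c ^+ (uphalf d - a./2)).
  rewrite mxE [RHS]big_mkcond; apply: eq_bigr => d _; rewrite !mxE odd_a /=.
  by case: (odd d); case: (a <= d)%N; case: (d <= b)%N;
    rewrite /= ?mulr1 ?mulr0 ?mul0r.
rewrite (sum_odd_ord (fun j => c ^+ (j - a./2)) le_ab).
rewrite -{1}[a./2]add0n big_addn big_mkord; apply: eq_bigr => j _.
by rewrite -addSn addnK.
Qed.

(** Telescoping, since x c^(j+1) = c^(j+1) - c^j. *)
Lemma sum_geo n : c ^+ n - x * \sum_(j < n) c ^+ j.+1 = 1.
Proof.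
elim: n => [|n IHn]; first by rewrite big_ord0 mulr0 subr0.
by rewrite big_ord_recr /= -[RHS]IHn -[c ^+ n]mulr1 -cE exprS; ring.
Qed.

(** Writing the solution of h(n) - x (h(1) + ... + h(n)) = c^n as c^n g(n) gives g(n+1) - g(n) = x c
    with g(0) = 1. *)
Lemma sum_geo_arith n :
  c ^+ n * (1 + n%:R * (x * c)) -
    x * \sum_(j < n) c ^+ j.+1 * (1 + j.+1%:R * (x * c)) = c ^+ n.
Proof.
have xc : x * c = c - 1 by rewrite -cE; ring.
elim: n => [|n IHn]; first by rewrite big_ord0 mul0r; ring.
rewrite big_ord_recr /=; set S := \sum_(j < n) _ in IHn *.
transitivity (c ^+ n.+1 * (1 - x) * (1 + n.+1%:R * (x * c)) - x * S).
  by ring.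
rewrite exprSr -(mulrA _ c) cE mulr1 -natr1.
transitivity ((c ^+ n * (1 + n%:R * (x * c)) - x * S) + c ^+ n * (x * c)).
  by ring.
by rewrite IHn xc; ring.
Qed.

(** With G = [evenmx_geo], the identity G - x G E = E gives (1 + x G) (1 - x E) = 1; a one-sided
    inverse of a square matrix is two-sided. *)
Lemma evenmx_resolvent :
  (1%:M - x *: evenmx) *m (1%:M + x *: evenmx_geo) = 1%:M.
Proof.
have fixG : evenmx_geo - x *: (evenmx_geo *m evenmx) = evenmx.
  apply/matrixP => a b.
  have [/andP[odd_a le_ab]|/negbTE ab] := boolP (odd a && (a <= b)%N).
    have := sum_geo (uphalf b - a./2); rewrite -geo_evenmx // => GE.
    by rewrite !mxE odd_a le_ab -[RHS]GE !mxE.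
  rewrite !mxE ab big1 ?mulr0 ?subr0 // => d _; rewrite !mxE.
  case: andP => [[odd_a le_ad]|_]; last by rewrite mul0r.
  case: andP => [[_ le_db]|_]; last by rewrite mulr0.
  by rewrite odd_a (leq_trans le_ad le_db) in ab.
apply: mulmx1C; rewrite mulmxDl mul1mx -scalemxAl mulmxBr mulmx1 -scalemxAr.
by rewrite fixG subrK.
Qed.

Lemma mxtrace_evenmx_geo : \tr evenmx_geo = k./2%:R * c.
Proof.
rewrite /mxtrace.
transitivity (\sum_(a < k) c *+ odd a).
  apply: eq_bigr => a _; rewrite mxE leqnn andbT uphalf_half.
  by case: odd; rewrite /= ?addnK ?expr1.
elim: k => [|n IHn]; first by rewrite big_ord0 mul0r.
rewrite big_ord_recr /= IHn uphalf_half natrD mulrDl addrC.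
by rewrite -[c *+ _]mulr_natl.
Qed.

Lemma sum_geo_odd n : x * \sum_(j < n) c ^+ j = (c ^+ n - 1) * (1 - x).
Proof.
elim: n => [|n IHn]; first by rewrite big_ord0; ring.
rewrite big_ord_recr /= mulrDr IHn.
have -> : (c ^+ n.+1 - 1) * (1 - x) = c ^+ n * (c * (1 - x)) - (1 - x).
  by rewrite exprS; ring.
by rewrite cE; ring.
Qed.

Lemma sum_geo_arith_odd n :
  \sum_(j < n) c ^+ j * (1 + j%:R * (x * c)) = 1 + (n%:R - 1) * c ^+ n.
Proof.
have xc : x * c = c - 1 by rewrite -cE; ring.
elim: n => [|n IHn]; first by rewrite big_ord0; ring.
by rewrite big_ord_recr /= IHn xc exprS -natr1; ring.
Qed.

Lemma mxtrace_even_up_resolvent (W : 'M[R]_k) :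
    (1%:M - x *: adjmx R (@even_up k)) *m W = 1%:M ->
  (1 - (c ^+ uphalf k - 1) * (1 - x)) * (\tr W - k%:R - k./2%:R * (x * c)) =
    x * (1 + ((uphalf k)%:R - 1) * c ^+ uphalf k).
Proof.
(* Even indices are the odd letters, whose rows are all 1; [u] absorbs the factor [x]. *)
pose u : 'cV[R]_k := \col_a (x *+ ~~ odd a).
have -> : 1%:M - x *: adjmx R (@even_up k) =
    (1%:M - x *: evenmx) - u *m const_mx 1.
  apply/matrixP => a b; rewrite !mxE big_ord1 !mxE /even_up /letter /= negbK.
  by case: odd => /=; rewrite ?ltnS; ring.
pose row h : 'rV[R]_k := \row_a h (uphalf a).
have rowu h : (row h *m u) 0 0 = x * \sum_(j < uphalf k) h j.
  rewrite -(sum_even_ord k h) mxE [in RHS]big_mkcond mulr_sumr.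
  apply: eq_bigr => a _.
  by rewrite !mxE; case: odd; rewrite /= ?mulr0 // mulrC.
(* The rows v B^-2 and v B^-1 for B = 1 - x E and v the all-one row. *)
pose y := row (fun j => c ^+ j * (1 + j%:R * (x * c))).
pose z := row (GRing.exp c).
have zB : z *m (1%:M - x *: evenmx) = const_mx 1.
  by rewrite row_resolvent_evenmx; apply/rowP => b; rewrite !mxE sum_geo.
have yB : y *m (1%:M - x *: evenmx) = z.
  by rewrite row_resolvent_evenmx; apply/rowP => b; rewrite !mxE sum_geo_arith.
move=> NW; have := mxtrace_rank1_update NW evenmx_resolvent zB yB.
rewrite !rowu sum_geo_odd sum_geo_arith_odd => <-; congr (_ * _).
by rewrite mxtraceD mxtrace1 mxtraceZ mxtrace_evenmx_geo; ring.
Qed.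

End Resolvent.

(** * Clearing denominators in the closed form *)

Theorem theorem7 (k : nat) (hk : (2 <= k)%N) :
  let x : fps rat := fpsX in
  gf_cyclic_weakly_even_up k =
    (k./2)%:R * (x / (1 - x)) +
    (2 * (1 - x) ^+ (uphalf k) + (uphalf k)%:R * x - 1) /
    ((2 - x) * (1 - x) ^+ (uphalf k) + x - 1).
Proof.
move=> x; set c := (1 - x)^-1.
have cE : c * (1 - x) = 1.
  by apply: mulVr; rewrite fps_unitE /= subr0 unitr1.
pose W : 'M[fps rat]_k :=
  \matrix_(a, b) Fps (fun n => (adjmx rat (@even_up k) ^+ n) a b).
(* In degree 0 the trace is [k], whereas there is one empty word. *)
have gfE : gf_cyclic_weakly_even_up k = \tr W - k%:R + 1.
  apply/eqP; rewrite addrAC -subr_eq opprK; apply/eqP/fpsP => n.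
  rewrite !fpscoefD !fpscoef_natr fpscoef_sum.
  rewrite (eq_bigr (fun i => (adjmx rat (@even_up k) ^+ n) i i)); last first.
    by move=> i _; rewrite mxE.
  case: n => [|n].
    rewrite [fpscoef _ _]/= nb_cyclic_weakly_even_up0 muln1 addrC.
    by rewrite -(mxtrace1 rat k) expr0.
  by rewrite [fpscoef _ _]/= nb_cyclic_weakly_even_upS muln0.
have WE := mxtrace_even_up_resolvent cE (resolvent_fps rat (@even_up k)).
rewrite -/W in WE.
have cXE : c ^+ uphalf k * (1 - x) ^+ uphalf k = 1.
  by rewrite -exprMn cE expr1n.
set Q := _ + x - 1.
(* The constant term of [Q] is 2 - 1 = 1. *)
have QU : Q \is a GRing.unit.
  have x0 : fpscoef (1 - x) 0 = 1 by rewrite /= subr0.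
  rewrite fps_unitE !fpscoefD fpscoefM0 fpscoefD !fpscoef_natr fpscoefX0 x0.
  by rewrite expr1n.
apply: (mulIr QU); rewrite mulrDl mulrVK // gfE.
(* Up to the factor (1 - x)^[uphalf k], [Q] is the Sherman-Morrison denominator 1 - z u. *)
have QE : Q = (1 - (c ^+ uphalf k - 1) * (1 - x)) * (1 - x) ^+ uphalf k.
  transitivity ((2 - x) * (1 - x) ^+ uphalf k -
    (c ^+ uphalf k * (1 - x) ^+ uphalf k) * (1 - x)); last by ring.
  by rewrite cXE /Q; ring.
apply/eqP; rewrite [eqbRHS]addrC -subr_eq; apply/eqP.
(* The term in [k./2] is moved to the left so that the left side of [WE] appears. *)
transitivity (Q + (1 - (c ^+ uphalf k - 1) * (1 - x)) *
    (\tr W - k%:R - k./2%:R * (x * c)) * (1 - x) ^+ uphalf k).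
  by rewrite [in LHS]QE {1}QE; ring.
rewrite WE.
transitivity (Q + x * ((1 - x) ^+ uphalf k +
    ((uphalf k)%:R - 1) * (c ^+ uphalf k * (1 - x) ^+ uphalf k))).
  by ring.
by rewrite cXE /Q; ring.
Qed.
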